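(* Let $L\subset\mathbb{Z}^n$ be a non-positive lattice. Then $I_L$ has no indispensable binomials, but it has one indispensable monomial, $1=x^{\mathbf 0}$. If $\operatorname{rank}(L_{pure})>1$ then there are no weakly indispensable binomials and only one weakly indispensable monomial, $1=x^{\mathbf 0}$. If $\operatorname{rank}(L_{pure})=1$ there exist exactly one weakly indispensable binomial (up to a constant multiple) and exactly two weakly indispensable monomials.
   Context: Let $\Bbbk$ be a field, $\mathbb{N}=\mathbb{Z}_{\ge0}$. A lattice is a subgroup $L\subset\mathbb{Z}^n$; it is non-positive if $L\cap\mathbb{N}^n\ne\{\mathbf 0\}$. $L_{pure}$ is the subgroup of $L$ generated by $L\cap\mathbb{N}^n$. The lattice ideal is $I_L=\langle x^u-x^v:u,v\in\mathbb{N}^n,\ u-v\in L\rangle\subset\Bbbk[x_1,\ldots,x_n]$. A binomial means a difference $x^u-x^v$ of two distinct monomials. A minimal generating set of $I_L$ is a set of binomials that is a minimal (under inclusion) system of generators of $I_L$; it is a cardinality-minimal generating set if it has the least cardinality among all minimal generating sets. A binomial is indispensable (resp. weakly indispensable) if it appears in every minimal generating set (resp. every cardinality-minimal generating set) of $I_L$ up to a constant multiple. A monomial $x^u$ is indispensable (resp. weakly indispensable) if for every minimal generating set (resp. every cardinality-minimal generating set) $S$ of $I_L$ there is a binomial $B\in S$ such that $x^u$ is a monomial term of $B$. *)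

(* Defs.v *)
From mathcomp Require Import all_boot all_order all_algebra.
From mathcomp Require Import boolp classical_sets functions cardinality.
From mathcomp Require Import mpoly.

Set Implicit Arguments.
Unset Strict Implicit.
Unset Printing Implicit Defensive.

Import GRing.Theory.
Local Open Scope ring_scope.
Local Open Scope classical_set_scope.
Local Open Scope card_scope.

Definition is_ideal (R : comNzRingType) (I : set R) : Prop :=
  [/\ I 0, forall a b, I a -> I b -> I (a + b) & forall a b, I b -> I (a * b)].

Definition ideal_gen (R : comNzRingType) (G : set R) : set R :=
  smallest (@is_ideal R) G.

Section Lattice.
Variable n : nat.
Implicit Types (L : set 'rV[int]_n) (u v : 'X_{1..n}).

Definition is_lattice L : Prop :=
  L 0 /\ forall a b, L a -> L b -> L (a - b).

Definition nonneg_orthant : set 'rV[int]_n :=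
  [set w | forall i, (0 <= w ord0 i)%R].

Definition nonpositive_lattice L : Prop := L `&` nonneg_orthant <> [set 0].

Definition subgroup_gen (A : set 'rV[int]_n) : set 'rV[int]_n :=
  smallest is_lattice A.

Definition Lpure L : set 'rV[int]_n := subgroup_gen (L `&` nonneg_orthant).

(* Maximal size of a family of vectors of [L] that is linearly independent over
   rat (equivalently, over int); such a family has at most [n] members. *)
Definition lattice_rank L : nat :=
  (\max_(r < n.+1 | `[< exists A : 'M[int]_(r, n),
      (forall i, L (row i A)) /\ row_free (map_mx intr A : 'M[rat]_(r, n))%R >]) r)%N.

Definition exp_diff u v : 'rV[int]_n := \row_i ((u i)%:Z - (v i)%:Z).

Variable k : fieldType.
Implicit Types (S T : set {mpoly k[n]}) (B : {mpoly k[n]}).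

Definition lattice_ideal L : set {mpoly k[n]} :=
  ideal_gen [set p | exists u v, L (exp_diff u v) /\ p = 'X_[u] - 'X_[v]].

Definition is_binomial B : Prop := exists u v, u != v /\ B = 'X_[u] - 'X_[v].

Definition min_gen_set L S : Prop :=
  [/\ S `<=` is_binomial,
      ideal_gen S = lattice_ideal L &
      forall T, T `<` S -> ideal_gen T <> lattice_ideal L].

Definition card_min_gen_set L S : Prop :=
  min_gen_set L S /\ forall T, min_gen_set L T -> S #<= T.

Definition in_up_to_constant B S : Prop := exists2 c : k, c != 0 & S (c *: B).

Definition indispensable_binomial L B : Prop :=
  is_binomial B /\ forall S, min_gen_set L S -> in_up_to_constant B S.

Definition weakly_indispensable_binomial L B : Prop :=
  is_binomial B /\ forall S, card_min_gen_set L S -> in_up_to_constant B S.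

(* A monomial x^u is represented by its exponent u; in particular the monomial 1
   is the exponent [0%MM]. *)
Definition indispensable_monomial L u : Prop :=
  forall S, min_gen_set L S -> exists2 B, S B & u \in msupp B.

Definition weakly_indispensable_monomial L u : Prop :=
  forall S, card_min_gen_set L S -> exists2 B, S B & u \in msupp B.

End Lattice.

Arguments indispensable_binomial {n} k L B.
Arguments weakly_indispensable_binomial {n} k L B.
Arguments indispensable_monomial {n} k L u.
Arguments weakly_indispensable_monomial {n} k L u.

(* Main.v *)
Require Import Defs.
From mathcomp Require Import all_boot all_order all_algebra.
From mathcomp Require Import boolp classical_sets functions cardinality.
From mathcomp Require Import mpoly.
From mathcomp Require Import ring zify.

Set Implicit Arguments.
Unset Strict Implicit.
Unset Printing Implicit Defensive.

Import Order.TTheory GRing.Theory Num.Theory.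
Local Open Scope ring_scope.
Local Open Scope classical_set_scope.
Local Open Scope card_scope.

(** For exponents [u] and [v], the binomial [x^u - x^v] lies in [I_L] exactly
    when [u - v] lies in [L] ([cong_lattice_ideal]); binomials are therefore
    rewriting rules between monomials, and a set of binomials generates [I_L] when
    its rules connect all monomials that are congruent modulo [L].

    The monomial [1] is indispensable: since [L] contains a nonzero nonnegative
    vector [w], the ideal contains [x^w - 1], which does not vanish at the origin,
    so some generator has a nonzero constant term ([one_indispensable]).

    Every other monomial can be avoided, thanks to the monomials that are
    invertible modulo [I_L].  They form a face of [N^n], and a binomial of [I_L]
    has either both terms in that face or none.  Rewriting [1] into [x^m], for
    [m] in [L], stays inside the face, so the exponent differences of the
    generators with invertible terms span [Lpure L] ([pure_span]).  Conversely
    these generators may be replaced by [x^w - 1], for [w] in any list of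
    nonnegative vectors that spans [Lpure L], and at the same time the other
    generators may be multiplied by a monomial [x^e] congruent to [1]
    ([replacement_gens]).  If the spanning list has length at least two, a
    unimodular change of generators makes all its members nonnegative and of
    large degree ([large_span]).  Taking [e] large as well, no generator retains a
    given monomial other than [1] ([avoid_monomial]).

    Without a constraint on the cardinality the list of differences can be padded
    with zeros, so its length is not an obstacle; a minimal generating set is then
    extracted from a finite one.  For cardinality-minimal generating sets the
    padding is not allowed, but if [Lpure L] has rank greater than one, the
    differences already number at least two, and the replacement keeps the number
    of generators.

    If the rank is one, [Lpure L] is generated by a single nonnegative vector [w]
    ([rank1_generator]).  One replacement [x^w - 1] suffices, so a
    cardinality-minimal generating set has exactly one binomial with invertible
    terms; since one of its terms must be [1], it is [x^w - 1] up to sign.  All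
    other generators can still be multiplied by a large [x^e], so [1] and [x^w]
    are the only monomials that cannot be avoided.

    In all cases both terms of an unavoidable binomial are unavoidable monomials,
    which settles the statements on binomials. *)

(** * Generated ideals and monomial congruences *)

Section Ideals.
Variable R : comNzRingType.
Implicit Types (I G : set R).

Lemma idealN I a : is_ideal I -> I a -> I (- a).
Proof. by case=> _ _ IM Ia; rewrite -mulN1r; apply: IM. Qed.

Lemma ideal_gen_ideal G : is_ideal (ideal_gen G).
Proof.
split=> [I [[]] //|a b Ia Ib I IG|a b Ib I IG].
  by case: (IG) => -[_ ID _] _; apply: ID; [apply: Ia | apply: Ib].
by case: (IG) => -[_ _ IM] _; apply: IM; apply: Ib.
Qed.

Lemma sub_ideal_gen G : G `<=` ideal_gen G.
Proof. exact: sub_gen_smallest. Qed.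

Lemma ideal_gen_sub G I : is_ideal I -> G `<=` I -> ideal_gen G `<=` I.
Proof. exact: smallest_sub. Qed.

End Ideals.

Section Congruence.
Variables (n : nat) (k : fieldType).
Implicit Types (J G : set {mpoly k[n]}) (u v w : 'X_{1..n}).

Definition cong J u v := J ('X_[u] - 'X_[v]).

Section Laws.
Variable J : set {mpoly k[n]}.
Hypothesis idJ : is_ideal J.

Lemma cong_refl u : cong J u u.
Proof. by rewrite /cong subrr; case: idJ. Qed.

Lemma cong_sym u v : cong J u v -> cong J v u.
Proof. by rewrite /cong => /(idealN idJ); rewrite opprB. Qed.

Lemma cong_trans v u w : cong J u v -> cong J v w -> cong J u w.
Proof.
by rewrite /cong => uv vw; rewrite -(subrKA 'X_[v]); case: idJ => _ ID _; apply: ID.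
Qed.

Lemma cong_add w u v : cong J u v -> cong J (u + w) (v + w).
Proof. by rewrite /cong => uv; rewrite !mpolyXD -mulrBl mulrC; case: idJ => _ _; apply. Qed.

Lemma cong_add_one u w : cong J w 0%MM -> cong J (u + w) u.
Proof. by move=> /(cong_add u); rewrite add0m addmC. Qed.

Lemma cong_unit u v p q : cong J p 0%MM -> cong J q 0%MM ->
  (u + q = v + p)%MM -> cong J u v.
Proof.
move=> p1 q1 e; apply: (@cong_trans (u + q)%MM); first exact/cong_sym/cong_add_one.
by rewrite e; apply: cong_add_one.
Qed.

End Laws.

(** The linear functional with prescribed values on monomials.  Such functionals
    serve to show that a polynomial lies outside an ideal. *)
Definition linext (f : 'X_{1..n} -> k) (p : {mpoly k[n]}) : k :=
  \sum_(m <- msupp p) p@_m * f m.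

Lemma linext_widen f p (s : seq 'X_{1..n}) : uniq s -> {subset msupp p <= s} ->
  linext f p = \sum_(m <- s) p@_m * f m.
Proof.
move=> us ps; rewrite [RHS](bigID (mem (msupp p))) /= [X in _ + X]big1 ?addr0; last first.
  by move=> m mp; rewrite memN_msupp_eq0 ?mul0r.
rewrite -big_filter; apply: perm_big; apply: uniq_perm; rewrite ?filter_uniq //.
by move=> m; rewrite mem_filter; case: (boolP (m \in _)) => //= /ps ->.
Qed.

Lemma linextD f p q : linext f (p + q) = linext f p + linext f q.
Proof.
set s := undup (msupp p ++ msupp q).
have us : uniq s by apply: undup_uniq.
rewrite !(@linext_widen _ _ s us); first 1 last.
- by move=> m mq; rewrite mem_undup mem_cat mq orbT.
- by move=> m mp; rewrite mem_undup mem_cat mp.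
- by move=> m /msuppD_le; rewrite mem_undup.
by rewrite -big_split; apply: eq_bigr => m _; rewrite mcoeffD mulrDl.
Qed.

Lemma linext0 f : linext f 0 = 0.
Proof. by rewrite /linext msupp0 big_nil. Qed.

Lemma linextZX f (c : k) m : linext f (c *: 'X_[m]) = c * f m.
Proof.
rewrite (@linext_widen _ _ [:: m]) ?big_seq1 //; last first.
  by move=> m' /msuppZ_le; rewrite msuppX.
by rewrite mcoeffZ mcoeffX eqxx mulr1.
Qed.

Lemma linext_binomial f u v : linext f ('X_[u] - 'X_[v]) = f u - f v.
Proof.
rewrite linextD -[X in linext f X + _]scale1r linextZX mul1r.
by rewrite -scaleN1r linextZX mulN1r.
Qed.

Lemma linextM f p q :
  linext f (p * q) = \sum_(a <- msupp p) p@_a * linext (fun m => f (a + m)%MM) q.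
Proof.
rewrite mpolyME (big_morph _ (linextD f) (linext0 f)) big_allpairs /=.
apply: eq_bigr => a _; rewrite [in RHS]/linext big_distrr /=; apply: eq_bigr => b _.
by rewrite linextZX mulrA.
Qed.

Definition shift_closed (F : set ('X_{1..n} -> k)) :=
  forall f a, F f -> F (fun m => f (a + m)%MM).

(** A shift-closed family of functionals annihilates an ideal.  Hence a relation
    [x^u = x^v] modulo the ideal generated by [G] is respected by every function
    of a shift-closed family that respects [G]. *)
Lemma cong_gen_invariant F G u v : shift_closed F ->
  (forall p f, G p -> F f -> linext f p = 0) ->
  cong (ideal_gen G) u v -> forall f, F f -> f u = f v.
Proof.
move=> shF GF uv f Ff; apply/eqP; rewrite -subr_eq0 -linext_binomial.
have: ideal_gen G `<=` [set p | forall g, F g -> linext g p = 0].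
  apply: ideal_gen_sub => [|p Gp g Fg]; last exact: GF.
  split=> [g _|a b a0 b0 g Fg|a b b0 g Fg] /=; first exact: linext0.
    by rewrite linextD a0 // b0 // addr0.
  by rewrite linextM big1 // => m _; rewrite b0 ?mulr0 //; apply: shF.
by move/(_ _ uv) => /= ->.
Qed.

Lemma mem_msupp_binomial u v w : u != v ->
  (w \in msupp ('X_[u] - 'X_[v] : {mpoly k[n]})) = (w == u) || (w == v).
Proof.
move=> uv; rewrite mcoeff_msupp mcoeffB !mcoeffX ![_ == w]eq_sym.
have [->|wu] := eqVneq w u; first by rewrite (negbTE uv) subr0 oner_eq0.
by have [//|wv] := eqVneq w v; rewrite ?sub0r ?oppr_eq0 ?oner_eq0 ?subrr ?eqxx.
Qed.

End Congruence.

(** * Lattices *)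

Section Lattices.
Variable n : nat.
Implicit Types (L A D : set 'rV[int]_n) (x y z : 'rV[int]_n) (u v w m : 'X_{1..n}).

Lemma lattN L x : is_lattice L -> L x -> L (- x).
Proof. by case=> L0 LB Lx; rewrite -sub0r; apply: LB. Qed.

Lemma lattD L x y : is_lattice L -> L x -> L y -> L (x + y).
Proof. by move=> lL Lx Ly; rewrite -[y]opprK; case: (lL) => _; apply=> //; apply: lattN. Qed.

Lemma lattB L x y : is_lattice L -> L x -> L y -> L (x - y).
Proof. by case=> _; apply. Qed.

Lemma lattMn L x i : is_lattice L -> L x -> L (x *+ i).
Proof.
move=> lL Lx; elim: i => [|i IHi]; first by case: lL.
by rewrite mulrS; apply: lattD.
Qed.

Lemma lattZ L x (c : int) : is_lattice L -> L x -> L (c *: x).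
Proof.
move=> lL Lx; rewrite -[c]intz scaler_int; case: c => i.
  by rewrite -pmulrn; apply: lattMn.
by rewrite NegzE mulrNz -pmulrn; apply: lattN => //; apply: lattMn.
Qed.

Lemma subgroup_gen_lattice A : is_lattice (subgroup_gen A).
Proof.
split=> [D [[]] //|x y Ax Ay D DA].
by case: (DA) => -[_ DB] _; apply: DB; [apply: Ax | apply: Ay].
Qed.

Lemma sub_subgroup_gen A : A `<=` subgroup_gen A.
Proof. exact: sub_gen_smallest. Qed.

Lemma subgroup_gen_sub A D : is_lattice D -> A `<=` D -> subgroup_gen A `<=` D.
Proof. exact: smallest_sub. Qed.

Lemma subgroup_gen_mono A D : A `<=` D -> subgroup_gen A `<=` subgroup_gen D.
Proof.
move=> AD; apply: subgroup_gen_sub; first exact: subgroup_gen_lattice.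
by apply: subset_trans AD _; apply: sub_subgroup_gen.
Qed.

Definition span (ds : seq 'rV[int]_n) := subgroup_gen [set` ds].

Lemma span_lattice ds : is_lattice (span ds).
Proof. exact: subgroup_gen_lattice. Qed.

Lemma mem_span ds d : d \in ds -> span ds d.
Proof. exact: sub_subgroup_gen. Qed.

Lemma span_sub ds D : is_lattice D -> (forall d, d \in ds -> D d) -> span ds `<=` D.
Proof. exact: subgroup_gen_sub. Qed.

Lemma span_mono ds es : {subset ds <= es} -> span ds `<=` span es.
Proof. exact: subgroup_gen_mono. Qed.

Lemma eq_span ds es : (forall d, d \in ds -> span es d) ->
  (forall e, e \in es -> span ds e) -> span ds = span es.
Proof. by move=> de ed; apply/seteqP; split; apply: span_sub => //; apply: span_lattice. Qed.

Lemma span_cons d (ds : seq 'rV[int]_n) x :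
  span (d :: ds) x -> exists a, exists2 y, span ds y & x = a *: d + y.
Proof.
move: x; apply: span_sub => [|x].
  split=> [|x1 x2 [a1 [y1 Dy1 ->]] [a2 [y2 Dy2 ->]]].
    by exists 0, 0; rewrite ?scale0r ?addr0 //; case: (span_lattice ds).
  exists (a1 - a2), (y1 - y2); first by apply: (lattB (span_lattice ds)).
  by rewrite scalerBl opprD addrACA.
rewrite inE => /orP[/eqP ->|xs].
  by exists 1, 0; rewrite ?scale1r ?addr0 //; case: (span_lattice ds).
by exists 0, x; rewrite ?scale0r ?add0r //; apply: mem_span.
Qed.

Lemma span1 d x : span [:: d] x -> exists a, x = a *: d.
Proof.
move=> /span_cons[a [y Dy ->]]; exists a.
suff -> : y = 0 by rewrite addr0.
move: y Dy; apply: (@span_sub [::] [set 0]) => //.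
by split=> [//|_ _ -> ->]; rewrite subrr.
Qed.

(** The Euclidean algorithm on the coefficients of [x], one vector of the list at a
    time.  Two vectors are dealt with by the unimodular change of basis
    built from a Bezout relation between the two coefficients. *)
Lemma span_adapted d (ds : seq 'rV[int]_n) x : span (d :: ds) x ->
  exists d' ds' (g : nat), [/\ size ds' = size ds,
    span (d' :: ds') = span (d :: ds) & x = g%:Z *: d'].
Proof.
elim: ds d x => [|e ds IHds] d x.
  move=> /span1[[g|g] ->]; first by exists d, [::], g.
  exists (- d), [::], g.+1; split=> //; last by rewrite NegzE scaleNr scalerN.
  have lat z := span_lattice [:: z].
  apply: eq_span => y; rewrite mem_seq1 => /eqP ->.
    by apply: (lattN (lat d)); apply: mem_span; apply: mem_head.
  by rewrite -[X in span _ X]opprK; apply: (lattN (lat _)); apply: mem_span; apply: mem_head.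
move=> /span_cons[a [y /IHds[e' [ds' [g [sz_ds' span_ds' ->]]]] ->]].
have span_de : span [:: d, e' & ds'] = span [:: d, e & ds].
  have sub (s : seq 'rV[int]_n) : {subset s <= d :: s}.
    by move=> z zs; rewrite inE zs orbT.
  apply: eq_span => z; rewrite inE => /orP[/eqP ->|zs]; 
    try by apply: mem_span; apply: mem_head.
    by apply: (span_mono (sub _)); rewrite -span_ds'; apply: mem_span.
  by apply: (span_mono (sub _)); rewrite span_ds'; apply: mem_span.
have [g0|h_neq0] := eqVneq (gcdz a g) 0.
  move/eqP: g0; rewrite gcdz_eq0 => /andP[/eqP -> /eqP [->]].
  by exists d, (e' :: ds'), 0%N; rewrite -span_de /= sz_ds' !scale0r addr0.
have [a' def_a] : exists a', a = a' * gcdz a g by apply/dvdzP/dvdz_gcdl.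
have [g' def_g] : exists g', g%:Z = g' * gcdz a g by apply/dvdzP/dvdz_gcdr.
have [p [q bez]] := Bezoutz a g.
have bez1 : p * a' + q * g' = 1.
  by apply: (mulIf h_neq0); rewrite mul1r mulrDl -!mulrA -def_a -def_g.
exists (a' *: d + g' *: e'), ((p *: e' - q *: d) :: ds'), (gcdn `|a| g).
split; first by rewrite /= sz_ds'.
  rewrite -span_de; apply: eq_span => z.
    have lat := span_lattice [:: d, e' & ds'].
    have Dd : span [:: d, e' & ds'] d by apply: mem_span; rewrite !inE eqxx.
    have De : span [:: d, e' & ds'] e' by apply: mem_span; rewrite !inE eqxx orbT.
    rewrite !inE => /or3P[/eqP ->|/eqP ->|zs].
    - by apply: (lattD lat); apply: (lattZ _ lat).
    - by apply: (lattB lat); apply: (lattZ _ lat).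
    - by apply: mem_span; rewrite !inE zs !orbT.
  set f1 := a' *: d + _; set f2 := p *: e' - _.
  have lat := span_lattice [:: f1, f2 & ds'].
  have D1 : span [:: f1, f2 & ds'] f1 by apply: mem_span; rewrite !inE eqxx.
  have D2 : span [:: f1, f2 & ds'] f2 by apply: mem_span; rewrite !inE eqxx orbT.
  rewrite !inE => /or3P[/eqP ->|/eqP ->|zs].
  - have -> : d = p *: f1 - g' *: f2.
      apply/rowP => i; rewrite !mxE -[LHS]mul1r -bez1; ring.
    by apply: (lattB lat); apply: (lattZ _ lat).
  - have -> : e' = q *: f1 + a' *: f2.
      apply/rowP => i; rewrite !mxE -[LHS]mul1r -bez1; ring.
    by apply: (lattD lat); apply: (lattZ _ lat).
  - by apply: mem_span; rewrite !inE zs !orbT.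
rewrite scalerDr !scalerA -/(gcdz a g) mulrC -def_a mulrC -def_g //.
Qed.

End Lattices.

(** * Exponent vectors *)

Section ExponentVectors.
Variable n : nat.
Implicit Types (L : set 'rV[int]_n) (x y z d : 'rV[int]_n) (u v w m : 'X_{1..n}).

Definition expvec m : 'rV[int]_n := \row_i (m i)%:Z.

Lemma expvecD u v : expvec (u + v)%MM = expvec u + expvec v.
Proof. by apply/rowP => i; rewrite !mxE mnmDE PoszD. Qed.

Lemma expvec0 : expvec 0%MM = 0.
Proof. by apply/rowP => i; rewrite !mxE mnm0E. Qed.

Lemma expvecMn u c : expvec (u *+ c)%MM = c%:Z *: expvec u.
Proof. by apply/rowP => i; rewrite !mxE mulmnE mulnC PoszM. Qed.

Lemma expvec_inj : injective expvec.
Proof.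
by move=> u v uv; apply/mnmP => i; have /rowP/(_ i) := uv; rewrite !mxE => -[].
Qed.

Lemma exp_diffE u v : exp_diff u v = expvec u - expvec v.
Proof. by apply/rowP => i; rewrite !mxE. Qed.

Lemma orthantP x : nonneg_orthant x <-> exists m, x = expvec m.
Proof.
split=> [x_ge0|[m -> i]]; last by rewrite mxE.
exists [multinom `|x ord0 i|%N | i < n]; apply/rowP => i.
by rewrite mxE mnmE gez0_abs //; apply: x_ge0.
Qed.

Lemma nonpositive_expvec L : is_lattice L -> nonpositive_lattice L ->
  exists2 w, w != 0%MM & L (expvec w).
Proof.
case=> L0 _ /eqP nonposL; apply: contrapT => no; case/eqP: nonposL.
apply/seteqP; split=> [x [Lx /orthantP[m def_x]]|_ ->]; last by split=> // i; rewrite mxE.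
rewrite def_x in Lx *; apply: contrapT => m0; apply: no; exists m => //.
by apply: contra_notN m0 => /eqP ->; rewrite expvec0.
Qed.

Lemma Lpure_lattice L : is_lattice (Lpure L).
Proof. exact: subgroup_gen_lattice. Qed.

Lemma LpureS L : is_lattice L -> Lpure L `<=` L.
Proof. by move=> lL; apply: subgroup_gen_sub => // x []. Qed.

Lemma Lpure_expvec L m : L (expvec m) -> Lpure L (expvec m).
Proof. by move=> Lm; apply: sub_subgroup_gen; split=> //; apply/orthantP; exists m. Qed.

Lemma Lpure_expvecB L u v : L (expvec u) -> L (expvec v) ->
  Lpure L (expvec u - expvec v).
Proof. by move=> Lu Lv; apply: (lattB (@Lpure_lattice L)); apply: Lpure_expvec. Qed.

(** The nonnegative vectors of [L] form a monoid, so the group that they generate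
    consists of the differences of two of them. *)
Lemma LpureP L x : is_lattice L -> Lpure L x ->
  exists u v, [/\ L (expvec u), L (expvec v) & x = expvec u - expvec v].
Proof.
move=> lL; have L0 : L (expvec 0) by rewrite expvec0; case: lL.
move: x; apply: subgroup_gen_sub => [|x [Lx /orthantP[m def_x]]].
  split=> [|_ _ [u1 [v1 [Lu1 Lv1 ->]]] [u2 [v2 [Lu2 Lv2 ->]]]].
    by exists 0%MM, 0%MM; rewrite subrr.
  exists (u1 + v2)%MM, (v1 + u2)%MM.
  split; rewrite !expvecD; try exact: (lattD lL).
  by rewrite opprB addrACA opprD.
by exists m, 0%MM; split; rewrite -?def_x // expvec0 subr0.
Qed.

(** A difference of two nonnegative vectors [u] and [v] of [L] is dominated by
    [u + v], and so is its opposite; these sums are added up over the list.  The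
    resulting [w] plays the part of a vector in the interior of the cone of
    nonnegative vectors of [L]. *)
Lemma Lpure_dominated L (ds : seq 'rV[int]_n) : is_lattice L ->
  nonpositive_lattice L -> (forall d, d \in ds -> Lpure L d) ->
  exists w, [/\ L (expvec w), w != 0%MM &
    forall d, d \in ds -> exists a b,
      expvec w = d + expvec a /\ expvec w = - d + expvec b].
Proof.
move=> lL npL; elim: ds => [_|d ds IHds dsP].
  by have [w w0 Lw] := nonpositive_expvec lL npL; exists w.
have [|w [Lw w0 domw]] := IHds; first by move=> e es; apply: dsP; rewrite inE es orbT.
have [|u [v [Lu Lv def_d]]] := @LpureP L d lL; first by apply: dsP; rewrite mem_head.
exists (u + v + w)%MM; split.
- by rewrite !expvecD; apply: (lattD lL) => //; apply: (lattD lL).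
- by rewrite mnmD_eq0 (negbTE w0) andbF.
move=> e; rewrite inE => /orP[/eqP ->|/domw[a [b [ea eb]]]].
  exists (v + v + w)%MM, (u + u + w)%MM; rewrite def_d !expvecD; split.
    by rewrite !addrA subrK.
  by rewrite !addrA opprB subrK [expvec v + _]addrC.
exists (u + v + a)%MM, (u + v + b)%MM; rewrite !expvecD; split.
  by rewrite [in LHS]ea addrCA.
by rewrite [in LHS]eb addrCA.
Qed.

(** The spanning list is adapted to a dominating vector, which makes its first
    member nonnegative.  Adding large multiples of that member to the others makes
    them nonnegative and large, and one of these is then added to the first
    member; that last step is where the length matters. *)
Lemma large_span L (ds : seq 'rV[int]_n) (N : nat) : is_lattice L ->
  nonpositive_lattice L -> (1 < size ds)%N ->
  (forall d, d \in ds -> Lpure L d) ->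
  (forall m, L (expvec m) -> span ds (expvec m)) ->
  exists ws : seq 'X_{1..n}, [/\ size ws = size ds,
    (forall w, w \in ws -> L (expvec w) /\ (N < mdeg w)%N) &
    (forall m, L (expvec m) -> span (map expvec ws) (expvec m))].
Proof.
move=> lL npL + dsP spanP; have [w0 [Lw0 nz_w0 domw]] := Lpure_dominated lL npL dsP.
have dom x : span ds x -> exists c a b,
    expvec w0 *+ c = x + expvec a /\ expvec w0 *+ c = - x + expvec b.
  move: x; apply: span_sub => [|d /domw]; last by exists 1%N.
  split=> [|x y [c [a [b [ea eb]]]] [c' [a' [b' [ea' eb']]]]].
    by exists 0%N, 0%MM, 0%MM; rewrite mulr0n expvec0 oppr0 addr0.
  exists (c + c')%N, (a + b')%MM, (b + a')%MM.
  rewrite mulrnDr !expvecD; split; first by rewrite ea eb' addrACA.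
  by rewrite eb ea' opprB addrACA [- x + y]addrC.
have spanL : span ds `<=` L.
  by apply: (span_sub lL) => d /dsP; apply: LpureS.
case: ds => [//|d ds] in dsP spanP domw dom spanL *.
have [d' [ds' [g [sz_ds' span_ds' def_w0]]]] := span_adapted (spanP _ Lw0).
rewrite /= -sz_ds' => size_ds'; rewrite -span_ds' in dom spanL.
have g_gt0 : (0 < g)%N.
  rewrite lt0n; apply: contra_neqN nz_w0 => /eqP g0; apply: expvec_inj.
  by rewrite def_w0 g0 scale0r expvec0.
have [|e def_e] := (orthantP d').1.
  move=> i; move/rowP: def_w0 => /(_ i); rewrite !mxE => wi.
  by rewrite -(@pmulr_rge0 _ g%:Z) ?ltz_nat // -wi.
have Le : L (expvec e) by rewrite -def_e; apply: spanL; apply: mem_span; apply: mem_head.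
have e_gt0 : (0 < mdeg e)%N.
  rewrite lt0n mdeg_eq0; apply: contra_neqN nz_w0 => /eqP e0; apply: expvec_inj.
  by rewrite def_w0 def_e e0 expvec0 scaler0.
have /choice[h hP] : forall f, exists m, f \in ds' ->
    (N < mdeg m)%N /\ exists c, expvec m = f + c *: expvec e.
  move=> f; case: (boolP (f \in ds')) => [fs|_]; last by exists 0%MM.
  have /dom[c [_ [b [_ def_b]]]] : span (d' :: ds') f.
    by apply: mem_span; rewrite inE fs orbT.
  exists (b + e *+ N.+1)%MM => _; split.
    by rewrite mdegD mdegMn; apply: leq_trans (leq_addl _ _); rewrite leq_pmull.
  exists (c%:Z * g%:Z + N.+1%:Z); rewrite expvecD expvecMn scalerDl addrA; congr (_ + _).
  apply: (addrI (- f)); rewrite -def_b addKr -scalerA -def_e -def_w0.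
  by rewrite -scaler_nat natz.
have Lh f : f \in ds' -> L (expvec (h f)).
  move=> fs; have [_ [c ->]] := hP f fs; apply: (lattD lL); last exact: (lattZ _ lL).
  by apply: spanL; apply: mem_span; rewrite inE fs orbT.
case: ds' => [//|f0 ds'] in sz_ds' span_ds' size_ds' dom spanL hP Lh *.
have f0s : f0 \in f0 :: ds' by apply: mem_head.
exists ((e + h f0)%MM :: map h (f0 :: ds')); split; first by rewrite /= size_map.
  move=> w; rewrite inE => /orP[/eqP ->|/mapP[f fs ->]].
    split; first by rewrite expvecD; apply: (lattD lL) => //; apply: Lh.
    by rewrite mdegD; apply: leq_trans (leq_addl _ _); case: (hP f0 f0s).
  by split; [apply: Lh | case: (hP f fs)].
move=> m /spanP; rewrite -span_ds'; move: (expvec m).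
set S := span (map _ _); have lS : is_lattice S := span_lattice _.
have Sh f : f \in f0 :: ds' -> S (expvec (h f)).
  by move=> fs; apply: mem_span; apply: map_f; rewrite inE map_f ?orbT.
have Se : S (expvec e).
  have -> : expvec e = expvec (e + h f0)%MM - expvec (h f0) by rewrite expvecD addrK.
  by apply: (lattB lS) => //; [apply: mem_span; rewrite /= mem_head | apply: Sh].
apply: (span_sub lS) => f; rewrite inE => /orP[/eqP ->|fs]; first by rewrite def_e.
have [_ [c hf]] := hP f fs.
have -> : f = expvec (h f) - c *: expvec e by rewrite hf addrK.
by apply: (lattB lS); [apply: Sh | apply: (lattZ _ lS)].
Qed.

(** * Lattices of rank at most one *)

Lemma rank_cyclic L d : (forall x, L x -> exists a, x = a *: d) ->
  (lattice_rank L <= 1)%N.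
Proof.
move=> Ld; apply/bigmax_leqP => r /asboolP[A [LA freeA]].
have [a def_A] := choice (fun i => Ld _ (LA i)).
have {}def_A : map_mx intr A = (\col_i (a i)%:~R) *m map_mx intr d :> 'M[rat]_(r, n).
  apply/matrixP => i j; rewrite !mxE big_ord1 !mxE -intrM.
  by have /rowP/(_ j) := def_A i; rewrite !mxE => ->.
rewrite -(eqP freeA) def_A; apply: leq_trans (mxrankM_maxl _ _) _.
exact: rank_leq_col.
Qed.

Lemma rank1_minors L x y : (lattice_rank L <= 1)%N -> L x -> L y ->
  forall i j, x 0 i * y 0 j = x 0 j * y 0 i.
Proof.
move=> rkL Lx Ly i j; apply: contrapT => xy.
pose A : 'M[int]_(2, n) := \matrix_(l < 2) (if l == 0 then x else y).
pose C : 'M[rat]_(n, 2) := \matrix_(l, c) (l == (if c == 0 then i else j))%:R.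
set M := map_mx intr A *m C.
have ME l c : M l c = (A l (if c == 0 then i else j))%:~R.
  rewrite mxE (bigD1 (if c == 0 then i else j)) //= big1 ?addr0 => [|b /negbTE nb].
    by rewrite !mxE eqxx mulr1.
  by rewrite !mxE nb mulr0.
have detM : \det M != 0.
  clearbody M; rewrite (expand_det_row _ 0) !big_ord_recl big_ord0 /cofactor !det_mx11.
  rewrite !mxE !ME !mxE /= addr0 expr0 expr1 mul1r mulN1r mulrN subr_eq0.
  by rewrite -!intrM eqr_int; apply/eqP.
have freeA : row_free (map_mx intr A : 'M[rat]_(2, n)).
  by apply/row_freeP; exists (C *m invmx M); rewrite mulmxA mulmxV // unitmxE unitfE.
have n_gt1 : (2 < n.+1)%N by rewrite ltnS -(eqP freeA) rank_leq_col.
have : (2 <= lattice_rank L)%N.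
  rewrite /lattice_rank; apply: (bigop.bigmax_sup (Ordinal n_gt1)) => //; apply/asboolP.
  exists A; split=> // l.
  by rewrite rowK; case: ifP.
by rewrite leqNgt ltnS rkL.
Qed.

(** In rank one, a nonzero nonnegative vector [w] of least degree spans all
    nonnegative vectors of the lattice: these are proportional to [w], and
    removing from one of them the integral part of the proportionality factor
    leaves a nonnegative vector of smaller degree. *)
Lemma rank1_generator L : is_lattice L -> nonpositive_lattice L ->
  (lattice_rank (Lpure L) <= 1)%N ->
  exists w, [/\ w != 0%MM, L (expvec w) &
    forall m, L (expvec m) -> exists c : nat, m = (w *+ c)%MM].
Proof.
move=> lL npL rk1; have [w1 nz_w1 Lw1] := nonpositive_expvec lL npL.
pose P (e : nat) := `[< exists w, [/\ w != 0%MM, L (expvec w) & mdeg w = e] >].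
have exP : exists e, P e by exists (mdeg w1); apply/asboolP; exists w1.
case: (ex_minnP exP) => e /asboolP[w [nz_w Lw dw]] min_e.
exists w; split=> // m Lm.
have /existsP[i w_i] : [exists i, (0 < w i)%N].
  apply: contraNT nz_w => /existsPn w0; apply/eqP/mnmP => i.
  by apply/eqP; rewrite mnm0E -leqn0 leqNgt.
have minor j : (m j * w i = m i * w j)%N.
  have := rank1_minors rk1 (Lpure_expvec Lm) (Lpure_expvec Lw) j i.
  by rewrite !mxE -!PoszM => -[].
exists (m i %/ w i)%N.
have le_cm : (w *+ (m i %/ w i) <= m)%MM.
  apply/mnm_lepP => j; rewrite mulmnE -(leq_pmul2r w_i) minor.
  by rewrite [leqRHS]mulnC -mulnA leq_mul2l leq_trunc_div orbT.
set y := (m - w *+ (m i %/ w i))%MM.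
have def_m : (m = y + w *+ (m i %/ w i))%MM by rewrite /y submK.
suff y0 : y = 0%MM by rewrite {1}def_m y0 add0m.
apply/eqP; apply: contraT => nz_y.
have Ly : L (expvec y).
  have -> : expvec y = expvec m - expvec (w *+ (m i %/ w i))%MM.
    by apply/eqP; rewrite eq_sym subr_eq -expvecD -def_m.
  by apply: (lattB lL) => //; rewrite expvecMn; apply: (lattZ _ lL).
have y_lt j : (y j * w i <= w j * (m i %% w i))%N.
  rewrite mnmBE mulmnE mulnBl minor; have := divn_eq (m i) (w i).
  by set q := (m i %/ w i)%N; set r := (m i %% w i)%N => ->; rewrite mulnDl; lia.
have : (e <= mdeg y)%N by apply: min_e; apply/asboolP; exists y.
rewrite -dw leqNgt; case/negP.
rewrite -(ltn_pmul2r w_i) !mdegE !big_distrl /=.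
have y_le j : (y j * w i <= w j * w i)%N.
  by apply: leq_trans (y_lt j) _; rewrite leq_mul2l ltnW ?orbT // ltn_mod.
rewrite (bigD1 i) //= [X in (_ < X)%N](bigD1 i) //= -addSn leq_add //.
  by apply: leq_ltn_trans (y_lt i) _; rewrite ltn_pmul2l // ltn_mod.
by apply: leq_sum.
Qed.

End ExponentVectors.

Arguments expvec {n} m.

(** * Dickson's lemma and cardinalities of lists *)

(** Dickson's lemma, for a finite family of functions on an arbitrary set in
    place of the coordinates of [nat^m]. *)
Lemma dickson (T : eqType) (fs : seq (T -> nat)) (A : set T) :
  exists2 s : seq T, [set` s] `<=` A &
    forall a, A a -> exists2 b, b \in s & all (fun f => f b <= f a)%N fs.
Proof.
elim: fs A => [|f fs IHfs] A.
  have [[a Aa]|noA] := pselect (exists a, A a).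
    by exists [:: a] => [b /=|b _];
      [rewrite mem_seq1 => /eqP -> | exists a; rewrite ?mem_head].
  by exists [::] => // a Aa; case: noA; exists a.
have [s0 s0A s0P] := IHfs A.
have /choice[t tP] : forall i, exists s : seq T, [set` s] `<=` A `&` [set a | f a = i]
    /\ forall a, (A a /\ f a = i) -> exists2 b, b \in s & all (fun f => f b <= f a)%N fs.
  move=> i; by have [s sA sP] := IHfs (A `&` [set a | f a = i]); exists s.
pose N := (\max_(b <- s0) f b)%N.
exists (s0 ++ flatten (map t (iota 0 N))).
  move=> a /=; rewrite mem_cat => /orP[/s0A //|/flatten_mapP[i _ ta]].
  by case: (tP i) => /(_ a ta)[].
move=> a Aa; have [b b_s0 b_le] := s0P a Aa.
have [fba|fab] := leqP (f b) (f a).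
  by exists b; rewrite ?mem_cat ?b_s0 //= fba.
have [_ /(_ a (conj Aa erefl))[b' b't b'_le]] := tP (f a).
exists b'; last first.
  by case: (tP (f a)) => /(_ b' b't)[_ /= ->] _; rewrite leqnn.
rewrite mem_cat; apply/orP; right; apply/flatten_mapP; exists (f a) => //.
by rewrite mem_iota add0n /=; apply: leq_trans fab _; rewrite leq_bigmax_seq.
Qed.

Lemma card_le_seq (T : choiceType) (s t : seq T) : uniq s -> uniq t ->
  ([set` s] #<= [set` t]) = (size s <= size t)%N.
Proof.
have card (r : seq T) : uniq r -> [set` r] #= `I_(size r).
  case: r => [_|x r ur]; first by
    rewrite II0 (_ : [set` [::]] = set0) ?card_eqxx //; apply/seteqP; split.
  rewrite (_ : [set` x :: r] = nth x (x :: r) @` `I_(size (x :: r))); last first.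
    apply/seteqP; split=> [y /= yr|_ [i /= ir <-]]; last first.
      by rewrite -/(nth x (x :: r) i) mem_nth.
    by exists (index y (x :: r)); [have := yr; rewrite -index_mem | rewrite nth_index].
  by apply: inj_card_eq => i j; rewrite !inE => /= ir jr /eqP; rewrite nth_uniq // => /eqP.
by move=> us ut; rewrite (card_le_eql (card s us)) (card_le_eqr (card t ut)) card_le_II.
Qed.


(** * Congruence modulo a lattice ideal *)

Section LatticeIdeal.
Variables (k : fieldType) (n : nat) (L : set 'rV[int]_n).
Hypothesis latL : is_lattice L.
Implicit Types (S T : set {mpoly k[n]}) (B : {mpoly k[n]}) (u v w m : 'X_{1..n}).
Implicit Types (s t : seq {mpoly k[n]}) (p q : 'X_{1..n} * 'X_{1..n}).
Implicit Types (ps qs : seq ('X_{1..n} * 'X_{1..n})).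

Local Notation I_L := (@lattice_ideal n k L).

(** The functions that are constant on the classes modulo [L] form a shift-closed
    family, and the indicator function of the class of [v] is one of them. *)
Lemma cong_lattice_ideal u v : cong I_L u v <-> L (expvec u - expvec v).
Proof.
split=> [uv|Luv]; last first.
  by apply: sub_ideal_gen; exists u, v; rewrite exp_diffE.
pose F := [set f : 'X_{1..n} -> k | forall a b, L (expvec a - expvec b) -> f a = f b].
pose f m : k := `[< L (expvec m - expvec v) >]%:R.
have shF : shift_closed F.
  by move=> g a Fg b c Lbc; apply: Fg; rewrite !expvecD opprD addrACA subrr add0r.
have Ff : F f.
  move=> a b Lab; congr (nat_of_bool _)%:R; apply/asboolP/asboolP => [La|Lb].
    rewrite -(subrKA (expvec a)) -[X in X + _]opprB.
    by apply: (lattD latL) => //; apply: lattN.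
  by rewrite -(subrKA (expvec b)); apply: (lattD latL).
have : f u = f v.
  apply: (cong_gen_invariant shF _ uv) => // _ g [a [b [Lab ->]]] Fg.
  by rewrite linext_binomial (Fg a b) ?subrr // -exp_diffE.
rewrite /f subrr; have -> : `[< L 0 >] by apply/asboolP; case: latL.
by case: asboolP => // _ /eqP; rewrite eq_sym oner_eq0.
Qed.

(** * Binomial generating sets *)

(** Lists of exponent pairs are preferred to lists of polynomials because they fix
    an orientation of each binomial, which is lost in characteristic two. *)
Definition binom p : {mpoly k[n]} := 'X_[p.1] - 'X_[p.2].

Definition binomial_gens S := S `<=` @is_binomial n k /\ ideal_gen S = I_L.

Lemma binomial_pairs s : [set` s] `<=` @is_binomial n k ->
  exists2 ps, s = map binom ps & forall p, p \in ps -> p.1 != p.2.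
Proof.
elim: s => [|B s IHs] binS; first by exists [::].
have [|ps -> psP] := IHs; first by move=> C Cs; apply: binS; rewrite /= inE Cs orbT.
have [|u [v [uv ->]]] := binS B; first exact: mem_head.
by exists ((u, v) :: ps) => // p; rewrite inE => /orP[/eqP ->|/psP].
Qed.

Lemma binomial_gens_pairs ps : (forall p, p \in ps -> p.1 != p.2) ->
  (forall p, p \in ps -> L (expvec p.1 - expvec p.2)) ->
  (forall u v, L (expvec u - expvec v) -> cong (ideal_gen [set` map binom ps]) u v) ->
  binomial_gens [set` map binom ps].
Proof.
move=> ps_neq psL ps_gen; split.
  by move=> _ /= /mapP[p pps ->]; exists p.1, p.2; split; first exact: ps_neq.
apply/seteqP; split; (apply: ideal_gen_sub; first exact: ideal_gen_ideal).
  by move=> _ /= /mapP[p pps ->]; apply/cong_lattice_ideal/psL.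
by move=> _ [u [v [Luv ->]]]; apply: ps_gen; rewrite -exp_diffE.
Qed.

Lemma binomial_gens_lattice ps p : ideal_gen [set` map binom ps] = I_L ->
  p \in ps -> L (expvec p.1 - expvec p.2).
Proof.
move=> psI pps; apply/cong_lattice_ideal; rewrite /cong -psI.
by apply: sub_ideal_gen; apply: map_f.
Qed.

(** The pairs [(u, v)] with [u - v] in [L] form a monoid closed under
    differences, so it is generated by its finitely many minimal nonzero
    elements. *)
Lemma finite_binomial_gens : exists s, binomial_gens [set` s].
Proof.
pose fs := [seq (fun p => p.1 i)%N | i <- index_enum (ordinal n)] ++
           [seq (fun p => p.2 i)%N | i <- index_enum (ordinal n)].
pose A := [set p | L (expvec p.1 - expvec p.2) /\ p != (0, 0)%MM].
have [ps psA psP] := dickson fs A.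
pose qs := [seq p <- ps | p.1 != p.2].
exists (map binom qs); apply: binomial_gens_pairs.
- by move=> p; rewrite mem_filter => /andP[].
- by move=> p; rewrite mem_filter => /andP[_ /psA[]].
set J := ideal_gen _; have idJ : is_ideal J := ideal_gen_ideal _.
move=> u v; have [N] := ubnP (mdeg u + mdeg v)%N; elim: N u v => // N IHN u v le_uv Luv.
case: (eqVneq (u, v) (0, 0)%MM) => [[-> ->]|nz_uv]; first exact: cong_refl.
have [[u' v'] ps_uv'] := psP (u, v) (conj Luv nz_uv).
rewrite all_cat !all_map => /andP[/allP le_u /allP le_v].
have {}le_u : (u' <= u)%MM by apply/mnm_lepP => i; apply: (le_u i); rewrite mem_index_enum.
have {}le_v : (v' <= v)%MM by apply/mnm_lepP => i; apply: (le_v i); rewrite mem_index_enum.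
have [/= Luv' nz_uv'] := psA _ ps_uv'.
have cong_uv' : cong J u' v'.
  have [->|uv'] := eqVneq u' v'; first exact: cong_refl.
  apply: sub_ideal_gen; apply/mapP; exists (u', v') => //.
  by rewrite mem_filter ps_uv' uv'.
have def_u := submK le_u; have def_v := submK le_v.
have cong_uv : cong J (u - u')%MM (v - v')%MM.
  apply: IHN.
    have : (0 < mdeg u' + mdeg v')%N.
      rewrite lt0n addn_eq0 !mdeg_eq0; apply: contraNN nz_uv'.
      by case/andP => /eqP -> /eqP ->.
    by move: le_uv; rewrite -[in X in X -> _]def_u -[in X in X -> _]def_v !mdegD; lia.
  have -> : expvec (u - u')%MM - expvec (v - v')%MM =
      expvec u - expvec v - (expvec u' - expvec v').
    apply/rowP => i; rewrite !mxE !mnmBE.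
    by have := mnm_lepP le_u i; have := mnm_lepP le_v i; lia.
  exact: lattB.
rewrite -def_u -def_v; apply: (cong_trans idJ (cong_add idJ u' cong_uv)).
by rewrite ![(v - v' + _)%MM]addmC; apply: (cong_add idJ).
Qed.

Lemma binomial_gens_minimal s : binomial_gens [set` s] ->
  exists t, [/\ {subset t <= s}, uniq t, (size t <= size s)%N &
                min_gen_set L [set` t]].
Proof.
have [N] := ubnP (size s); elim: N s => // N IHN s le_sN [binS genS].
have [[T [[TS nST] genT]]|minS] := pselect (exists T, T `<` [set` s] /\ ideal_gen T = I_L).
  pose t := [seq B <- s | `[< T B >]].
  have tT : [set` t] = T.
    apply/seteqP; split=> B /=; rewrite mem_filter; first by case/andP => /asboolP.
    by move=> TB; rewrite (TS B TB) andbT; apply/asboolP.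
  have lt_ts : (size t < size s)%N.
    rewrite size_filter ltn_neqAle count_size andbT -all_count; apply/negP => /allP sT.
    by apply: nST => B /sT /asboolP.
  have [|t' [t't ut' sz_t' min_t']] := IHN t (leq_trans lt_ts le_sN).
    by rewrite tT; split=> // B /TS /binS.
  exists t'; split=> //; last exact: leq_trans sz_t' (ltnW lt_ts).
  by move=> B /t't; rewrite mem_filter => /andP[].
exists (undup s); split; rewrite ?undup_uniq ?size_undup //.
  by move=> B; rewrite mem_undup.
have -> : [set` undup s] = [set` s] by apply/seteqP; split=> B /=; rewrite mem_undup.
by split=> // T TS genT; apply: minS; exists T.
Qed.

Lemma min_gen_binomial_gens S : min_gen_set L S -> binomial_gens S.
Proof. by case. Qed.

(** * Cardinality-minimal generating sets *)

Lemma card_min_gen_set_seq S : card_min_gen_set L S ->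
  exists2 s, uniq s & S = [set` s].
Proof.
case=> _ minS; have [s0 gen_s0] := finite_binomial_gens.
have [s1 [_ _ _ min_s1]] := binomial_gens_minimal gen_s0.
have /finite_seqP[s ->] : finite_set S by apply: card_le_finite (minS _ min_s1) _.
exists (undup s); first exact: undup_uniq.
by apply/seteqP; split=> B /=; rewrite mem_undup.
Qed.

Lemma card_min_gen_set_size s t : card_min_gen_set L [set` s] -> uniq s ->
  binomial_gens [set` t] -> (size s <= size t)%N.
Proof.
case=> _ minS us /binomial_gens_minimal[t' [_ ut' sz_t' min_t']].
by apply: leq_trans sz_t'; rewrite -card_le_seq //; apply: minS.
Qed.

(** This is how a monomial is shown to be avoidable: it suffices to avoid it in a
    generating list of the right length, minimal or not. *)
Lemma card_min_gen_set_sub s t : card_min_gen_set L [set` s] -> uniq s ->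
  binomial_gens [set` t] -> (size t <= size s)%N ->
  exists2 t' : seq {mpoly k[n]}, {subset t' <= t} & card_min_gen_set L [set` t'].
Proof.
case=> _ minS us /binomial_gens_minimal[t' [t't ut' sz_t' min_t']] sz_t.
exists t' => //; split=> // T min_T; apply: card_le_trans (minS T min_T).
by rewrite card_le_seq // (leq_trans sz_t').
Qed.

Lemma card_min_gen_set_exists : exists2 s : seq {mpoly k[n]}, uniq s &
  card_min_gen_set L [set` s].
Proof.
have [s0 gen_s0] := finite_binomial_gens.
have [s1 [_ us1 _ min_s1]] := binomial_gens_minimal gen_s0.
pose P N := `[< exists s : seq {mpoly k[n]},
  [/\ uniq s, min_gen_set L [set` s] & size s = N] >].
have exP : exists N, P N by exists (size s1); apply/asboolP; exists s1.
case: (ex_minnP exP) => N /asboolP[s [us min_s sz_s]] minN.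
exists s => //; split=> // T min_T.
have [/finite_seqP[t def_T]|] := pselect (finite_set T); last first.
  have /finite_setP[M sM] := finite_seq s.
  move=> /infiniteP; apply: card_le_trans; rewrite (card_le_eql sM).
  exact: subset_card_le.
have {}def_T : T = [set` undup t].
  by rewrite def_T; apply/seteqP; split=> B /=; rewrite mem_undup.
rewrite def_T card_le_seq ?undup_uniq // sz_s; apply: minN; apply/asboolP.
by exists (undup t); rewrite undup_uniq -def_T.
Qed.

(** * Monomials that are invertible modulo the lattice ideal *)

(** The class of [x^u] modulo the lattice ideal is invertible, with inverse the
    class of [x^v]. *)
Definition unit_monomial u := exists v, L (expvec (u + v)%MM).

Lemma unit_monomialD u v : unit_monomial (u + v)%MM <-> unit_monomial u /\ unit_monomial v.
Proof.
split=> [[w Lw]|[[u' Lu'] [v' Lv']]].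
  by split; [exists (v + w)%MM | exists (u + w)%MM]; rewrite addmA // [(v + u)%MM]addmC.
by exists (u' + v')%MM; rewrite !expvecD addrACA; apply: (lattD latL); rewrite -expvecD.
Qed.

Lemma expvec_exchange u v w :
  expvec (v + w)%MM = expvec (u + w)%MM - (expvec u - expvec v).
Proof. by rewrite !expvecD opprB addrCA [expvec u + _]addrC addrK addrC. Qed.

Lemma unit_monomial_cong u v : L (expvec u - expvec v) -> unit_monomial u ->
  unit_monomial v.
Proof.
move=> Luv [w Lw]; exists w.
rewrite (expvec_exchange u).
exact: lattB.
Qed.

Lemma unit_monomial_mem u : L (expvec u) -> unit_monomial u.
Proof. by exists 0%MM; rewrite addm0. Qed.

(** With [x^w] inverse to [x^u], the difference [u - v] is the difference of the
    nonnegative vectors [u + w] and [v + w], which lie in [L]. *)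
Lemma Lpure_unit u v : L (expvec u - expvec v) -> unit_monomial u ->
  Lpure L (expvec u - expvec v).
Proof.
move=> Luv Uu; have [w Lw] := Uu.
have -> : expvec u - expvec v = expvec (u + w)%MM - expvec (v + w)%MM.
  by rewrite !expvecD opprD addrACA subrr addr0.
apply: Lpure_expvecB => //.
rewrite (expvec_exchange u).
exact: lattB.
Qed.

Definition pure_pairs ps := [seq p <- ps | `[< unit_monomial p.1 >]].
Definition mixed_pairs ps := [seq p <- ps | ~~ `[< unit_monomial p.1 >]].
Definition diffs ps := [seq expvec p.1 - expvec p.2 | p <- ps].

Lemma size_pure_mixed ps : (size (pure_pairs ps) + size (mixed_pairs ps))%N = size ps.
Proof. by rewrite !size_filter count_predC. Qed.

(** A monomial [x^m] with [m] in [L] is congruent to [1], and every rewriting of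
    [1] into [x^m] by binomials of [I_L] only passes through invertible monomials.
    So it only uses the binomials with invertible terms, and [m] is an integral
    combination of their exponent differences. *)
Lemma pure_span ps m : ideal_gen [set` map binom ps] = I_L -> L (expvec m) ->
  span (diffs (pure_pairs ps)) (expvec m).
Proof.
move=> genps Lm; set D := span _; have latD : is_lattice D := span_lattice _.
pose F := [set f : 'X_{1..n} -> k | (forall a, ~ unit_monomial a -> f a = 0) /\
  forall a b, unit_monomial a -> unit_monomial b -> D (expvec a - expvec b) -> f a = f b].
have shF : shift_closed F.
  move=> f a [f0 fD]; split=> [b nUb|b c Ub Uc Dbc].
    by apply: f0; move/unit_monomialD => [].
  have [Ua|nUa] := pselect (unit_monomial a).
    apply: fD; [by apply/unit_monomialD | by apply/unit_monomialD |].
    by rewrite !expvecD opprD addrACA subrr add0r.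
  by rewrite !f0 // => /unit_monomialD[].
pose f a : k := `[< unit_monomial a /\ D (expvec a - expvec m) >]%:R.
have Ff : F f.
  split=> [a nUa|a b Ua Ub Dab]; first by rewrite /f asboolF // => -[].
  congr (nat_of_bool _)%:R; apply/asboolP/asboolP => -[_ Dm]; split=> //.
    rewrite -(subrKA (expvec a)) -[X in X + _]opprB.
    by apply: (lattD latD) => //; apply: (lattN latD).
  by rewrite -(subrKA (expvec b)); apply: (lattD latD).
have : f 0%MM = f m.
  have cong0m : cong (ideal_gen [set` map binom ps]) 0%MM m.
    by rewrite genps; apply/cong_lattice_ideal; rewrite expvec0 sub0r; apply: lattN.
  apply: (cong_gen_invariant shF _ cong0m) => // _ g /= /mapP[p pps ->] [g0 gD].
  rewrite linext_binomial; apply/eqP; rewrite subr_eq0; apply/eqP.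
  have Lp := binomial_gens_lattice genps pps.
  have [U1|nU1] := pselect (unit_monomial p.1).
    apply: gD => //; first exact: unit_monomial_cong Lp U1.
    by apply: mem_span; apply: map_f; rewrite mem_filter pps andbT; apply/asboolP.
  rewrite !g0 // => U2; apply: nU1; apply: unit_monomial_cong U2.
  by rewrite -opprB; apply: lattN.
rewrite /f [in RHS]asboolT; last first.
  by split; [exact: unit_monomial_mem | rewrite subrr; case: latD].
case: asboolP => [[_]|_ /eqP]; last by rewrite eq_sym oner_eq0.
by rewrite expvec0 sub0r => Dm _; rewrite -[expvec m]opprK; apply: (lattN latD).
Qed.

Definition replacement (ws : seq 'X_{1..n}) e ps :=
  [seq (w, 0%MM) | w <- ws] ++ [seq (p.1 + e, p.2 + e)%MM | p <- mixed_pairs ps].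

Lemma mem_replacement ws e ps q : q \in replacement ws e ps ->
  (exists2 w, w \in ws & q = (w, 0%MM)) \/
  (exists2 p, p \in ps & q = (p.1 + e, p.2 + e)%MM).
Proof.
rewrite mem_cat => /orP[/mapP[w ws_w ->]|/mapP[p]]; first by left; exists w.
by rewrite mem_filter => /andP[_ pps] ->; right; exists p.
Qed.

Lemma size_replacement ws e ps :
  size (map binom (replacement ws e ps)) = (size ws + size (mixed_pairs ps))%N.
Proof. by rewrite size_map size_cat !size_map. Qed.

(** Modulo the new binomials each [x^w] is congruent to [1], and so two monomials
    are congruent as soon as their exponents differ by an integral combination of
    the [w].  This gives back the replaced binomials, and also [x^e] congruent to
    [1], which gives back the others. *)
Lemma replacement_gens ws e ps : binomial_gens [set` map binom ps] ->
  (forall p, p \in ps -> p.1 != p.2) ->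
  (forall w, w \in ws -> L (expvec w) /\ w != 0%MM) -> L (expvec e) ->
  (forall m, L (expvec m) -> span (map expvec ws) (expvec m)) ->
  binomial_gens [set` map binom (replacement ws e ps)].
Proof.
move=> [_ genps] ps_neq wsL Le ws_span.
set J := ideal_gen [set` map binom (replacement ws e ps)].
have idJ : is_ideal J := ideal_gen_ideal _.
have mem_cong q : q \in replacement ws e ps -> cong J q.1 q.2.
  by move=> qr; apply: sub_ideal_gen; apply: map_f.
pose D := [set x | exists a b,
  [/\ cong J a 0%MM, cong J b 0%MM & x = expvec a - expvec b]].
have latD : is_lattice D.
  split=> [|_ _ [a [b [a1 b1 ->]]] [a' [b' [a'1 b'1 ->]]]].
    by exists 0%MM, 0%MM; rewrite subrr; split=> //; apply: cong_refl.
  exists (a + b')%MM, (b + a')%MM; split.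
  - exact: (cong_trans idJ (cong_add_one idJ a b'1) a1).
  - exact: (cong_trans idJ (cong_add_one idJ b a'1) b1).
  - by rewrite !expvecD opprB addrACA opprD.
have spanD : span (map expvec ws) `<=` D.
  apply: span_sub => // _ /mapP[w ws_w ->]; exists w, 0%MM; split.
  - by apply: (mem_cong (w, 0%MM)); rewrite mem_cat map_f.
  - exact: cong_refl.
  - by rewrite expvec0 subr0.
have congD a b : D (expvec a - expvec b) -> cong J a b.
  move=> [c [d [c1 d1 e_ab]]]; apply: (cong_unit idJ c1 d1); apply: expvec_inj.
  rewrite !expvecD; move/eqP: e_ab; rewrite subr_eq addrAC eq_sym subr_eq => /eqP <-.
  by rewrite addrC.
have cong_e a : cong J (a + e)%MM a.
  apply: (cong_add_one idJ); apply: congD; rewrite expvec0 subr0.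
  by apply: spanD; apply: ws_span.
apply: binomial_gens_pairs.
- move=> q /mem_replacement[[w /wsL[_ nz_w] ->] //|[p pps ->] /=].
  by rewrite eqm_add2r ps_neq.
- move=> q /mem_replacement[[w /wsL[Lw _] ->]|[p pps ->]] /=.
    by rewrite expvec0 subr0.
  rewrite !expvecD opprD addrACA subrr addr0.
  exact: binomial_gens_lattice genps pps.
move=> u v /cong_lattice_ideal; rewrite /cong -genps; apply: (@ideal_gen_sub _ _ J) => //.
move=> _ /= /mapP[p pps ->]; rewrite -[J _]/(cong J p.1 p.2).
have Lp := binomial_gens_lattice genps pps.
have [U1|nU1] := pselect (unit_monomial p.1).
  have [a [b [La Lb def_p]]] := LpureP latL (Lpure_unit Lp U1).
  by apply: congD; rewrite def_p; apply: (lattB latD); apply: spanD; apply: ws_span.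
apply: (cong_trans idJ (cong_sym idJ (cong_e p.1))); apply: (cong_trans idJ _ (cong_e p.2)).
apply: (mem_cong (_, _)); rewrite mem_cat; apply/orP; right; apply: map_f.
by rewrite mem_filter pps andbT; apply/asboolP.
Qed.

(** * Indispensable monomials *)

(** If no generator had a constant term, all functionals supported at the monomial
    [1] would vanish on the ideal, although it contains [x^w - 1]. *)
Lemma one_indispensable S : nonpositive_lattice L -> binomial_gens S ->
  exists2 B, S B & 0%MM \in msupp B.
Proof.
move=> npL [_ genS]; apply: contrapT => noB.
have [w nz_w Lw] := nonpositive_expvec latL npL.
pose F := [set f : 'X_{1..n} -> k | forall a, a != 0%MM -> f a = 0].
have shF : shift_closed F.
  move=> f a f0 b nz_b; apply: f0; rewrite mnmD_eq0 negb_and nz_b orbT //.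
have cong_w : cong (ideal_gen S) w 0%MM.
  by rewrite genS; apply/cong_lattice_ideal; rewrite expvec0 subr0.
pose f (a : 'X_{1..n}) : k := (a == 0%MM)%:R.
suff : f w = f 0%MM by rewrite /f eqxx (negbTE nz_w) => /eqP; rewrite eq_sym oner_eq0.
apply: (cong_gen_invariant shF _ cong_w) => [B g SB g0|a /negbTE]; last by rewrite /f => ->.
rewrite /linext big_seq big1 // => a Ba.
have [a0|/g0 ->] := eqVneq a 0%MM; last by rewrite mulr0.
by case: noB; exists B; rewrite -?a0.
Qed.

(** Both the exponents [w] and the exponent [e] of a replacement are chosen of
    degree greater than [N]. *)
Lemma avoid_monomial N ds ps : nonpositive_lattice L ->
  binomial_gens [set` map binom ps] -> (forall p, p \in ps -> p.1 != p.2) ->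
  (1 < size ds)%N -> (forall d, d \in ds -> Lpure L d) ->
  (forall m, L (expvec m) -> span ds (expvec m)) ->
  exists s, [/\ binomial_gens [set` s],
    size s = (size ds + size (mixed_pairs ps))%N &
    forall B u, B \in s -> u \in msupp B -> u != 0%MM -> (N < mdeg u)%N].
Proof.
move=> npL genps ps_neq ds_gt1 dsP ds_span.
have [ws [sz_ws wsP ws_span]] := large_span N latL npL ds_gt1 dsP ds_span.
have [e nz_e Le] := nonpositive_expvec latL npL.
exists (map binom (replacement ws (e *+ N.+1)%MM ps)); split.
- apply: replacement_gens => //; last by rewrite expvecMn; apply: lattZ.
  move=> w /wsP[Lw lt_Nw]; split=> //.
  by rewrite -mdeg_eq0 -lt0n (leq_ltn_trans _ lt_Nw).
- by rewrite size_replacement sz_ws.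
move=> _ u /mapP[q qr ->]; case/mem_replacement: qr => [[w /wsP[_ lt_Nw] ->]|[p pps ->]].
  rewrite mem_msupp_binomial /= => [/orP[/eqP -> //|/eqP -> /eqP]//|].
  by rewrite -mdeg_eq0 -lt0n (leq_ltn_trans _ lt_Nw).
have big a : (N < mdeg (a + e *+ N.+1))%N.
  by rewrite mdegD mdegMn (leq_trans _ (leq_addl _ _)) // leq_pmull // lt0n mdeg_eq0.
by rewrite mem_msupp_binomial /= ?eqm_add2r ?ps_neq // => /orP[/eqP ->|/eqP ->].
Qed.

Lemma diffs_pure_Lpure ps d : ideal_gen [set` map binom ps] = I_L ->
  d \in diffs (pure_pairs ps) -> Lpure L d.
Proof.
move=> genps /mapP[p]; rewrite mem_filter => /andP[/asboolP Up pps ->].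
by apply: Lpure_unit => //; apply: binomial_gens_lattice genps pps.
Qed.

Lemma not_indispensable_monomial u : nonpositive_lattice L -> u != 0%MM ->
  ~ indispensable_monomial k L u.
Proof.
move=> npL nz_u ind_u; have [s gens] := finite_binomial_gens.
have [ps def_s ps_neq] := binomial_pairs gens.1; rewrite {s}def_s in gens.
(* The cardinality being free, zero vectors are added so that the list has at least two members. *)
pose ds := diffs (pure_pairs ps) ++ [:: 0; 0].
have dsP d : d \in ds -> Lpure L d.
  rewrite mem_cat => /orP[/(diffs_pure_Lpure gens.2) //|].
  by rewrite !inE orbb => /eqP ->; case: (Lpure_lattice L).
have ds_span m : L (expvec m) -> span ds (expvec m).
  move=> /(pure_span gens.2); apply: span_mono => d d_pure.
  by rewrite mem_cat d_pure.
have ds_gt1 : (1 < size ds)%N by rewrite size_cat addn2.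
have [t [gent _ tP]] := avoid_monomial (mdeg u) npL gens ps_neq ds_gt1 dsP ds_span.
have [t' [t't _ _ min_t']] := binomial_gens_minimal gent.
have [B /= t'B uB] := ind_u _ min_t'.
by have := tP B u (t't _ t'B) uB nz_u; rewrite ltnn.
Qed.

(** The differences of the generators with invertible terms span [Lpure L], so in
    rank greater than one they number at least two, and a replacement of the same
    length avoids [x^u]. *)
Lemma not_weakly_indispensable_monomial u : nonpositive_lattice L ->
  (1 < lattice_rank (Lpure L))%N -> u != 0%MM -> ~ weakly_indispensable_monomial k L u.
Proof.
move=> npL rk_gt1 nz_u ind_u; have [s us min_s] := card_min_gen_set_exists.
have gens := min_gen_binomial_gens min_s.1.
have [ps def_s ps_neq] := binomial_pairs gens.1; rewrite {s}def_s in gens us min_s.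
pose ds := diffs (pure_pairs ps).
have dsP d : d \in ds -> Lpure L d by apply: diffs_pure_Lpure gens.2.
have ds_span m : L (expvec m) -> span ds (expvec m) by apply: pure_span gens.2.
have ds_gt1 : (1 < size ds)%N.
  rewrite ltnNge; apply: contraL rk_gt1 => ds_le1; rewrite -leqNgt.
  have [d dsd] : exists d, span ds `<=` span [:: d].
    case: ds ds_le1 {dsP ds_span} => [|d [|//]] _; last by exists d.
    by exists 0; apply: span_mono.
  apply: (@rank_cyclic _ _ d) => x Lx; apply: span1; apply: dsd; move: x Lx.
  apply: (subgroup_gen_sub (span_lattice ds)) => x [Lx /orthantP[m def_x]].
  by rewrite def_x; apply: ds_span; rewrite -def_x.
have [t [gent sz_t tP]] := avoid_monomial (mdeg u) npL gens ps_neq ds_gt1 dsP ds_span.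
have [|t' t't min_t'] := card_min_gen_set_sub min_s us gent.
  by rewrite sz_t !size_map size_pure_mixed.
have [B /= t'B uB] := ind_u _ min_t'.
by have := tP B u (t't _ t'B) uB nz_u; rewrite ltnn.
Qed.

Section RankOne.
Variable w : 'X_{1..n}.
Hypotheses (npL : nonpositive_lattice L) (nz_w : w != 0%MM) (Lw : L (expvec w)).
Hypothesis w_gen : forall m, L (expvec m) -> exists c : nat, m = (w *+ c)%MM.

Let span_w m : L (expvec m) -> span (map expvec [:: w]) (expvec m).
Proof.
move=> /w_gen[c ->]; rewrite expvecMn; apply: (lattZ _ (span_lattice _)).
by apply: mem_span; rewrite mem_head.
Qed.

Let gens_w v : v \in [:: w] -> L (expvec v) /\ v != 0%MM.
Proof. by rewrite mem_seq1 => /eqP ->. Qed.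

(** By minimality of the cardinality only one binomial has invertible terms, for
    [x^w - 1] could replace all of them.  One of its terms is [1], and the exponent
    of the other one generates the same group as [w]. *)
Lemma rank1_weakly_indispensable_binomial :
  weakly_indispensable_binomial k L (binom (w, 0%MM)).
Proof.
split; first by exists w, 0%MM.
move=> S min_S; have [s us def_S] := card_min_gen_set_seq min_S; rewrite {S}def_S in min_S *.
have gens := min_gen_binomial_gens min_S.1.
have [ps def_s ps_neq] := binomial_pairs gens.1; rewrite {s}def_s in gens us min_S *.
have L0 : L (expvec 0) by rewrite expvec0; case: latL.
have le1 : (size (pure_pairs ps) <= 1)%N.
  have := card_min_gen_set_size min_S us (replacement_gens gens ps_neq gens_w L0 span_w).
  by rewrite size_replacement size_map -(size_pure_mixed ps) leq_add2r.
have [_ /= /mapP[p pps ->]] := one_indispensable npL gens.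
rewrite mem_msupp_binomial ?ps_neq // => p0.
have Lp := binomial_gens_lattice gens.2 pps.
have Up : unit_monomial p.1.
  case/orP: p0 => /eqP p0; first by apply: unit_monomial_mem; rewrite -p0.
  by apply: unit_monomial_mem; move: Lp; rewrite -p0 expvec0 subr0.
have pure_p : pure_pairs ps = [:: p].
  have : p \in pure_pairs ps by rewrite mem_filter pps andbT; apply/asboolP.
  by case: (pure_pairs ps) le1 => [|q [|//]] // _; rewrite mem_seq1 => /eqP ->.
have [a def_w] : exists a, expvec w = a *: (expvec p.1 - expvec p.2).
  by apply: span1; have := pure_span gens.2 Lw; rewrite pure_p.
have eq_w v b : L (expvec v) -> expvec w = b *: expvec v -> v = w.
  move=> /w_gen[c def_v]; rewrite def_v expvecMn scalerA => /rowP bc.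
  have /existsP[i w_i] : [exists i, (0 < w i)%N].
    apply: contraNT nz_w => /existsPn w0; apply/eqP/mnmP => i.
    by apply/eqP; rewrite mnm0E -leqn0 leqNgt.
  have bc1 : b * c%:Z = 1.
    by apply: (@mulIf _ (w i)%:Z); [rewrite -lt0n | have := bc i; rewrite !mxE mul1r].
  have c1 : c = 1%N.
    by move/(congr1 absz)/eqP: bc1; rewrite abszM muln_eq1 => /andP[_ /eqP].
  by rewrite c1 mulm1n.
case/orP: p0 => /eqP p0; move: def_w Lp; rewrite -p0 expvec0.
  rewrite sub0r scalerN -scaleNr => def_w /(lattN latL); rewrite opprK => Lp2.
  have p2 := eq_w _ _ Lp2 def_w.
  exists (-1); first by rewrite oppr_eq0 oner_eq0.
  apply/mapP; exists p => //; rewrite /binom -p0 p2 scaleN1r opprB //.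
rewrite subr0 => def_w Lp1; have p1 := eq_w _ _ Lp1 def_w.
exists 1; first exact: oner_neq0.
by apply/mapP; exists p => //; rewrite /binom -p0 p1 scale1r.
Qed.

(** The generator with invertible terms is replaced by [x^w - 1] and the others are
    multiplied by a power of [x^w] of degree greater than that of [x^u]. *)
Lemma rank1_not_weakly_indispensable u : u != 0%MM -> u != w ->
  ~ weakly_indispensable_monomial k L u.
Proof.
move=> nz_u u_w ind_u; have [s us min_s] := card_min_gen_set_exists.
have gens := min_gen_binomial_gens min_s.1.
have [ps def_s ps_neq] := binomial_pairs gens.1; rewrite {s}def_s in gens us min_s.
have pure_gt0 : (0 < size (pure_pairs ps))%N.
  rewrite lt0n; apply: contraNneq nz_w => /size0nil pure0; apply/eqP/expvec_inj.
  have := pure_span gens.2 Lw; rewrite pure0 expvec0; apply: (@span_sub _ _ [set 0]) => //.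
  by split=> // _ _ -> ->; rewrite subrr.
pose e := (w *+ (mdeg u).+1)%MM.
have Le : L (expvec e) by rewrite expvecMn; apply: lattZ.
have gent := replacement_gens gens ps_neq gens_w Le span_w.
have [|t' t't min_t'] := card_min_gen_set_sub min_s us gent.
  by rewrite size_replacement size_map -(size_pure_mixed ps) leq_add2r.
have [B /= /t't /mapP[q qr ->]] := ind_u _ min_t'.
case/mem_replacement: qr => [[v]|[p pps]]; last first.
  have big a : (a + e)%MM != u.
    suff : (mdeg u < mdeg (a + e))%N by apply: contraTneq => ->; rewrite ltnn.
    rewrite mdegD mdegMn (leq_trans _ (leq_addl _ _)) // leq_pmull //.
    by rewrite lt0n mdeg_eq0.
  move=> ->; rewrite mem_msupp_binomial /= ?eqm_add2r ?ps_neq // ![u == _]eq_sym.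
  by rewrite !(negbTE (big _)).
rewrite mem_seq1 => /eqP -> ->.
by rewrite mem_msupp_binomial //= (negbTE u_w) (negbTE nz_u).
Qed.

End RankOne.

End LatticeIdeal.

(** A nonzero multiple of a binomial has the same terms, so an unavoidable binomial
    has two unavoidable terms.  The family [Q] stands for all minimal generating
    sets, or for the cardinality-minimal ones. *)
Lemma binomial_terms (k : fieldType) (n : nat) (Q : set (set {mpoly k[n]}))
    (B : {mpoly k[n]}) :
  is_binomial B -> (forall S, Q S -> in_up_to_constant B S) ->
  exists u v, [/\ u != v, B = 'X_[u] - 'X_[v],
    forall S, Q S -> exists2 C, S C & u \in msupp C &
    forall S, Q S -> exists2 C, S C & v \in msupp C].
Proof.
move=> [u [v [uv ->]]] QB; exists u, v.
by split=> // S /QB[c nz_c Sc]; exists (c *: ('X_[u] - 'X_[v])); rewrite //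
  (perm_mem (msuppZ _ nz_c)) mem_msupp_binomial // eqxx ?orbT.
Qed.

Theorem theorem4p18 (k : fieldType) (n : nat) (L : set 'rV[int]_n)
    (latL : is_lattice L) (nonposL : nonpositive_lattice L) :
  [/\ (~ exists B : {mpoly k[n]}, indispensable_binomial k L B)
      /\ (forall u : 'X_{1..n}, indispensable_monomial k L u <-> u = 0%MM),
      (1 < lattice_rank (Lpure L))%N ->
        (~ exists B : {mpoly k[n]}, weakly_indispensable_binomial k L B)
        /\ (forall u : 'X_{1..n},
              weakly_indispensable_monomial k L u <-> u = 0%MM)
    & lattice_rank (Lpure L) = 1%N ->
        (exists B : {mpoly k[n]},
            weakly_indispensable_binomial k L B
            /\ forall B' : {mpoly k[n]}, weakly_indispensable_binomial k L B' ->
                 exists2 c : k, c != 0 & B' = c *: B)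
        /\ (exists u v : 'X_{1..n},
              u != v
              /\ forall w : 'X_{1..n},
                   weakly_indispensable_monomial k L w <-> w = u \/ w = v)].
Proof.
have min_one : indispensable_monomial k L 0%MM.
  by move=> S /min_gen_binomial_gens; apply: one_indispensable.
have weak_one : weakly_indispensable_monomial k L 0%MM.
  by move=> S [min_S _]; apply: min_one.
have ind_mono u : indispensable_monomial k L u <-> u = 0%MM.
  split=> [ind_u|-> //]; apply/eqP; apply: contraT => nz_u.
  by case: (not_indispensable_monomial latL nonposL nz_u ind_u).
split=> [|rk_gt1|rk1].
- split=> // -[B [binB /(binomial_terms binB)[u [v [/eqP uv _ /ind_mono u0 /ind_mono v0]]]]].
  by apply: uv; rewrite u0 v0.
- have weak_mono u : weakly_indispensable_monomial k L u <-> u = 0%MM.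
    split=> [ind_u|-> //]; apply/eqP; apply: contraT => nz_u.
    by case: (not_weakly_indispensable_monomial latL nonposL rk_gt1 nz_u ind_u).
  split=> // -[B [binB /(binomial_terms binB)[u [v [/eqP uv _ /weak_mono u0 /weak_mono v0]]]]].
  by apply: uv; rewrite u0 v0.
have [|w [nz_w Lw w_gen]] := rank1_generator latL nonposL; first by rewrite rk1.
have weak_w := rank1_weakly_indispensable_binomial k latL nonposL nz_w Lw w_gen.
have weak_mono u : weakly_indispensable_monomial k L u <-> u = w \/ u = 0%MM.
  split=> [ind_u|[->|-> //]].
    have [->|u_w] := eqVneq u w; first by left.
    have [->|nz_u] := eqVneq u 0%MM; first by right.
    by case: (rank1_not_weakly_indispensable latL nz_w Lw w_gen nz_u u_w ind_u).
  by move=> S /weak_w.2[c nz_c Sc]; exists (c *: binom k (w, 0%MM));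
    rewrite // (perm_mem (msuppZ _ nz_c)) mem_msupp_binomial // eqxx.
split; last by exists w, 0%MM.
exists (binom k (w, 0%MM)); split=> // B.
move=> [binB /(binomial_terms binB)[u [v [uv -> /weak_mono u_w0 /weak_mono v_w0]]]].
case: u_w0 v_w0 uv => -> [] ->; rewrite ?eqxx // => _.
  by exists 1; rewrite ?oner_neq0 // scale1r.
by exists (-1); rewrite ?oppr_eq0 ?oner_eq0 // scaleN1r opprB.
Qed.
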